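(* Let $2\le k<d$, let $V=\{1,\dots,d\}$, and let $\mathbf X=(X_1,\dots,X_d)^T$ be a continuous random vector whose joint density is the $k$-th order $t$-cherry junction tree density $$f_V(\mathbf x)=\frac{\prod_{K\in\mathcal C_{ch}} f_K(\mathbf x_K)}{\prod_{S\in\mathcal S_{ch}}\left(f_S(\mathbf x_S)\right)^{\nu_S-1}}$$ associated with a $k$-th order $t$-cherry junction tree on $V$ with cluster set $\mathcal C_{ch}$ and separator set $\mathcal S_{ch}$, where $f_K,f_S$ are the corresponding marginal densities of $f_V$ and $\nu_S$ is the number of clusters containing $S$. Suppose that the separators in $\mathcal S_{ch}$ form (are the clusters of) a $(k-1)$-th order $t$-cherry junction tree. Let $T_1,\dots,T_k$ be a cherry-wine structure obtained from this $t$-cherry junction tree; that is, $T_k$ is the given $t$-cherry junction tree, $T_{k-1},\dots,T_1$ are produced from it by the descending construction described in the context, and $T_1,\dots,T_k$ are the first $k$ trees of a Regular-vine structure. Then the $t$-cherry copula density of $\mathbf X$ is equal to the cherry-wine copula density: with $\mathbf u_V=(F_1(x_1),\dots,F_d(x_d))$, $$\frac{\prod_{K\in\mathcal C_{ch}} c_K(\mathbf u_K)}{\prod_{S\in\mathcal S_{ch}}\left[c_S(\mathbf u_S)\right]^{\nu_S-1}} =\left[\prod_{\{l,m\}\in E_1} c_{l,m}\left(F_l(x_l),F_m(x_m)\right)\right]\cdot\prod_{i=2}^{k-1}\ \prod_{\{e,e'\}} c_{a,b|S}\left(F_{a|S}(x_a|\mathbf x_S),F_{b|S}(x_b|\mathbf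 x_S)\right),$$ where $E_1$ is the edge set of $T_1$, the inner product runs over all pairs $\{e,e'\}$ of clusters linked in the junction tree $T_i$, and for such a pair $S=e\cap e'$, $\{a\}=e\setminus S$, $\{b\}=e'\setminus S$.
   Context: **Junction trees.** A junction tree on $V$ is a tree whose nodes are subsets of $V$ (clusters) covering $V$, none contained in another, satisfying the running intersection property (if a vertex lies in two clusters, it lies in every cluster on the tree path joining them). To each edge of the tree joining clusters $C,C'$ is assigned the separator $C\cap C'$. A vertex contained in only one cluster is called simplicial; a cluster containing a simplicial vertex is called a leaf cluster. **$k$-th order $t$-cherry junction tree.** A $k$-th order $t$-cherry tree is a graph constructed recursively: (i) the complete graph on $k-1$ vertices is the smallest one; (ii) given a $k$-th order $t$-cherry tree, a new vertex $i_k$ is connected to all vertices $i_1,\dots,i_{k-1}$ of a complete subgraph on $k-1$ vertices of the existing graph, and the result is again a $k$-th order $t$-cherry tree; (iii) all are obtained in this way. The associated $k$-th order $t$-cherry junction tree has as clusters the $k$-element sets $\{i_1,\dots,i_{k-1},i_k\}$ arising in step (ii), linked into a junction tree in which all separators are the $(k-1)$-element sets $\{i_1,\dots,i_{k-1}\}$. $\mathcal C_{ch}$ and $\mathcal S_{ch}$ denote the sets of clusters and of separators; $\nu_S$ is the number of clusters containing $S$. **Regular-vine structure.** It is a sequence $T_1,\dots,T_{d-1}$ such that: $T_1$ is a tree on the vertex set $V$ with edge set $E_1$; $T_2$ is a second order $t$-cherry junction tree on $V$ whose clusters are the edges of $T_1$; for $m\ge 3$, $T_m$ is an $m$-th order $t$-cherry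 junction tree on $V$ whose $d-m+1$ clusters, of size $m$, are exactly the unions of pairs of clusters linked in $T_{m-1}$. Two edges of $T_{m-1}$, regarded as clusters of $T_m$, may be linked in $T_m$ only if they share a common node (end point) in $T_{m-1}$. **Descending construction (cherry-wine structure).** Start with the given $k$-th order $t$-cherry junction tree $T_k$. For $m=k,k-1,\dots,2$ obtain $T_{m-1}$ from $T_m$ as follows. Step 1: the separators of $T_m$ become clusters of $T_{m-1}$; two different such separators are linked in $T_{m-1}$ if there is one cluster between them in $T_m$. Step 2: each leaf cluster of $T_m$ is transformed into an $(m-1)$-element cluster by deleting from it a vertex that is not simplicial; the resulting cluster is linked in $T_{m-1}$ to the Step 1 cluster which was the separator attached to that leaf cluster in $T_m$. (For $m=2$ the one-element clusters of $T_1$ are the vertices of $T_1$ and the links are its edges.) The Regular-vine structure obtained in this way is called a cherry-wine structure; the construction may allow several choices. **Densities and copulas.** For $D\subset V$, $f_D$ is the marginal density of $\mathbf X_D=(X_i)_{i\in D}$, $F_i$ is the distribution function of $X_i$, and $c_D$ is the copula density of $\mathbf X_D$, i.e. $f_D(\mathbf x_D)=c_D(\mathbf u_D)\prod_{i\in D}f_i(x_i)$ with $\mathbf u_D=(F_i(x_i))_{i\in D}$ (so $c_D=1$ if $|D|=1$). For $i,j\in V\setminus D$, $F_{i|D}(\cdot|\mathbf x_D)$ is the conditional distribution function of $X_i$ given $\mathbf X_D=\mathbf x_D$, and $c_{i,j|D}$ is the conditional copula density, i.e. the copula density of the conditional density $f_{i,j|D}$ of $(X_i,X_j)$ given $\mathbf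 X_D=\mathbf x_D$ (it may depend on $\mathbf x_D$). Equalities of densities are understood at almost every $\mathbf x$ with $f_V(\mathbf x)>0$. The copula density on the left-hand side of the claim is called the $t$-cherry copula density; the right-hand side is the cherry-wine copula density. *)

(* Defs.v *)
From HB Require Import structures.
From mathcomp Require Import all_boot all_order all_algebra.
From mathcomp Require Import all_classical all_reals all_analysis.

Set Implicit Arguments.
Unset Strict Implicit.
Unset Printing Implicit Defensive.

Import Order.TTheory GRing.Theory Num.Theory.

Local Open Scope ring_scope.

Section cons_measure.
Local Open Scope classical_set_scope.
Context (R : realType) (n : nat).
Variable m : {sigma_finite_measure set (n.-tuple R) -> \bar R}.

Definition tuple_of_pair (p : R * n.-tuple R) : n.+1.-tuple R :=
  [tuple of p.1 :: p.2].

Lemma measurable_tuple_of_pair : measurable_fun [set: _] tuple_of_pair.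
Proof. exact: measurable_cons. Qed.

(* product of the Lebesgue measure on the head and m on the tail *)
Definition cons_measure : set (n.+1.-tuple R) -> \bar R :=
  pushforward (@lebesgue_measure R \x m)%E tuple_of_pair.

Let cons_measure0 : cons_measure set0 = 0%E.
Proof. by rewrite /cons_measure /pushforward preimage_set0 measure0. Qed.

Let cons_measure_ge0 A : (0 <= cons_measure A)%E.
Proof. exact: (measure_ge0 (@lebesgue_measure R \x m)%E). Qed.

Let cons_measure_sigma_additive : semi_sigma_additive cons_measure.
Proof.
move=> F mF tF mUF; rewrite /cons_measure /pushforward preimage_bigcup.
apply: measure_semi_sigma_additive.
- by move=> i; rewrite -[X in measurable X]setTI; exact: measurable_tuple_of_pair.
- apply/trivIsetP => /= i j _ _ ij; rewrite -preimage_setI.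
  by move/trivIsetP : tF => /(_ _ _ _ _ ij) ->//; rewrite preimage_set0.
- rewrite -preimage_bigcup -[X in measurable X]setTI.
  exact: measurable_tuple_of_pair.
Qed.

HB.instance Definition _ := isMeasure.Build _ _ _ cons_measure
  cons_measure0 cons_measure_ge0 cons_measure_sigma_additive.

Let cons_measure_sigma_finite : sigma_finite setT cons_measure.
Proof.
have /sigma_finiteP[F [TF ndF Foo]] := sigma_finiteT (@lebesgue_measure R).
have /sigma_finiteP[G [TG ndG Goo]] := sigma_finiteT m.
pose g (t : n.+1.-tuple R) : R * n.-tuple R := (thead t, [tuple of behead t]).
have gK : cancel tuple_of_pair g.
  move=> [a b]; rewrite /g /tuple_of_pair /=; congr pair.
  by apply: val_inj.
have mg : measurable_fun setT g.
  apply/measurable_fun_pairP; split; last exact: measurable_behead.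
  exact: measurable_tnth.
exists (fun k => g @^-1` (F k `*` G k)).
  rewrite -preimage_bigcup; apply/esym; rewrite -subTset => t _ /=.
  have [i _ Fi] : (\bigcup_i F i) (g t).1 by rewrite -TF.
  have [j _ Gj] : (\bigcup_i G i) (g t).2 by rewrite -TG.
  exists (maxn i j) => //; split.
  - by move: (g t).1 Fi; exact/subsetPset/ndF/leq_maxl.
  - by move: (g t).2 Gj; exact/subsetPset/ndG/leq_maxr.
move=> k; have [mF Fk] := Foo k; have [mG Gk] := Goo k.
have mFG : measurable (F k `*` G k) by exact: measurableX.
split; first by rewrite -[X in measurable X]setTI; exact: mg.
rewrite /cons_measure /pushforward -comp_preimage.
rewrite (_ : g \o tuple_of_pair = id); last by rewrite funeqE => z /=; rewrite gK.
by rewrite preimage_id product_measure1E// lte_mul_pinfty// ge0_fin_numE.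
Qed.

HB.instance Definition _ := Measure_isSigmaFinite.Build _ _ _ cons_measure
  cons_measure_sigma_finite.

End cons_measure.

Fixpoint lebesgue_tuple (R : realType) (n : nat) :
    {sigma_finite_measure set (n.-tuple R) -> \bar R} :=
  match n with
  | 0 => \d_[tuple]
  | n'.+1 => cons_measure (lebesgue_tuple R n')
  end.

Section densities.
Local Open Scope classical_set_scope.
Context d0 (Omega : measurableType d0) (R : realType) (P : probability Omega R).
Context (d : nat) (X : 'I_d -> {RV P >-> R}).

(* x_D, with the elements of D in increasing order *)
Definition coords (A : Type) (D : {set 'I_d}) (x : 'I_d -> A) : #|D|.-tuple A :=
  [tuple x (enum_val j) | j < #|D|].

Definition is_density (D : {set 'I_d}) (g : #|D|.-tuple R -> R) : Prop :=
  [/\ measurable_fun [set: #|D|.-tuple R] g, (forall y, 0 <= g y) &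
   forall B : set (#|D|.-tuple R), measurable B ->
     P [set w | B (coords D (fun i => X i w))] =
       (\int[lebesgue_tuple R #|D|]_(y in B) (g y)%:E)%E].

(* f D is (a version of) the density of X_D, as a function on R^D *)
Variable f : forall D : {set 'I_d}, #|D|.-tuple R -> R.

Definition marg (D : {set 'I_d}) (x : 'I_d -> R) : R := f (coords D x).

(* Q at almost every x with f_V(x) > 0, the sense in which densities are equal *)
Definition ae_support (Q : ('I_d -> R) -> Prop) : Prop :=
  {ae lebesgue_tuple R d, forall x : d.-tuple R,
    0 < marg [set: 'I_d] (tnth x) -> Q (tnth x)}.

(* u_V = (F_1(x_1), ..., F_d(x_d)) *)
Definition cdfs (x : 'I_d -> R) : 'I_d -> R := fun i => fine (cdf (X i) (x i)).

(* Only the values of c at almost all points u_D with f_V(x) > 0 are determined *)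
Definition copula_density (D : {set 'I_d}) (c : #|D|.-tuple R -> R) : Prop :=
  [/\ measurable_fun [set: #|D|.-tuple R] c, (forall u, 0 <= c u) &
   ae_support (fun x =>
     marg D x = c (coords D (cdfs x)) * \prod_(i in D) marg [set i] x)].

(* f_{A|S}(x_A | x_S) *)
Definition cond_density (A S : {set 'I_d}) (x : 'I_d -> R) : R :=
  marg (A :|: S) x / marg S x.

(* F_{i|S}(x_i | x_S), for i outside S *)
Definition cond_cdf (i : 'I_d) (S : {set 'I_d}) (x : 'I_d -> R) : R :=
  fine (\int[@lebesgue_measure R]_(s in `]-oo, x i])
    (cond_density [set i] S (fun j => if j == i then s else x j))%:E)%E.

(* c z u v is the value at (u, v) of the copula density of (X_a, X_b) given
   X_S = z *)
Definition cond_copula_density (a b : 'I_d) (S : {set 'I_d})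
    (c : #|S|.-tuple R -> R -> R -> R) : Prop :=
  [/\ measurable_fun [set: #|S|.-tuple R * (R * R)]
        (fun p => c p.1 p.2.1 p.2.2),
      (forall z u v, 0 <= c z u v) &
   ae_support (fun x =>
     cond_density [set a; b] S x =
       c (coords S x) (cond_cdf a S x) (cond_cdf b S x) *
       (cond_density [set a] S x * cond_density [set b] S x))].

End densities.

Section junction_trees.
Variable V : finType.

Record cluster_graph := ClusterGraph {
  clusters : {set {set V}};
  link : rel {set V}
}.
Implicit Types (G : cluster_graph) (K S W : {set V}) (v : V).

Definition is_tree G : Prop :=
  [/\ clusters G != finset.set0,
      (forall K K', link G K K' -> K \in clusters G /\ K' \in clusters G),
      irreflexive (link G) /\ symmetric (link G),
      {in clusters G &, forall K K', connect (link G) K K'} &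
      (forall p : seq {set V}, ucycle (link G) p -> (size p <= 2)%N)].

Definition running_intersection G : Prop :=
  forall K (p : seq {set V}) v, K \in clusters G ->
    path (link G) K p -> uniq (K :: p) -> v \in K -> v \in last K p ->
    forall K', K' \in p -> v \in K'.

Definition junction_tree W G : Prop :=
  [/\ is_tree G, finset.cover (clusters G) = W,
      {in clusters G &, forall K K', K \subset K' -> K = K'} &
      running_intersection G].

Definition separators G : {set {set V}} :=
  [set K :&: K' | K in clusters G, K' in clusters G & link G K K'].

Definition nu G S : nat := #|[set K in clusters G | S \subset K]|.

Definition simplicial G v : bool := #|[set K in clusters G | v \in K]| == 1%N.

Definition leaf_cluster G K : bool :=
  (K \in clusters G) && [exists v in K, simplicial G v].

Definition complete_edges W : {set {set V}} := [set e in powerset W | #|e| == 2%N].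

(* tcherry_tree k W E C A: the graph with vertex set W and edge set E is a k-th
   order t-cherry tree, with a construction in which the sets {i_1, ..., i_k}
   form C and the sets {i_1, ..., i_(k-1)} form A *)
Inductive tcherry_tree (k : nat) :
    {set V} -> {set {set V}} -> {set {set V}} -> {set {set V}} -> Prop :=
| tcherry_base W : #|W| = k.-1 ->
    tcherry_tree k W (complete_edges W) finset.set0 finset.set0
| tcherry_step W E C A S v : tcherry_tree k W E C A ->
    S \subset W -> #|S| = k.-1 -> complete_edges S \subset E -> v \notin W ->
    tcherry_tree k (v |: W) (E :|: [set [set v; i] | i in S])
      ((v |: S) |: C) (S |: A).

Definition tcherry_junction_tree (k : nat) W G : Prop :=
  junction_tree W G /\
  exists E A, tcherry_tree k W E (clusters G) A /\ separators G \subset A.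

Definition share_node G (e e' : {set V}) : Prop :=
  exists N K K', [/\ link G N K, link G N K', e = N :|: K & e' = N :|: K'].

(* The nodes of T 1 are the singletons {v}, so that in every T m the edge {K, K'}
   becomes the cluster K :|: K' of T m.+1. *)
Definition regular_vine (T : nat -> cluster_graph) : Prop :=
  [/\ is_tree (T 1%N),
      clusters (T 1%N) = [set [set v] | v : V] &
      forall m, (2 <= m < #|V|)%N ->
      [/\ tcherry_junction_tree m [set: V] (T m),
          clusters (T m) = [set K :|: K' | K in clusters (T m.-1),
                              K' in clusters (T m.-1) & link (T m.-1) K K'],
          #|clusters (T m)| = (#|V| - m + 1)%N,
          {in clusters (T m), forall K, #|K| = m} &
          (forall e e', link (T m) e e' -> share_node (T m.-1) e e')]].

Definition separators_linked G (S S' : {set V}) : Prop :=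
  S <> S' /\ exists K K1 K2,
    [/\ link G K1 K, link G K K2, S = K1 :&: K & S' = K :&: K2].

(* del K is the vertex deleted from the leaf cluster K *)
Definition leaf_linked G (del : {set V} -> V) (A S : {set V}) : Prop :=
  exists K K', [/\ leaf_cluster G K, link G K K', A = K :\ del K & S = K :&: K'].

(* One stage T_m -> T_(m-1) of the descending construction: separators become
   clusters, leaf clusters lose a non-simplicial vertex, and G' has exactly the
   links this prescribes. *)
Definition descends G G' : Prop :=
  exists del : {set V} -> V,
  [/\ (forall K, leaf_cluster G K -> del K \in K /\ ~~ simplicial G (del K)),
      clusters G' = separators G :|: [set K :\ del K | K in leaf_cluster G] &
      (forall A B, link G' A B <->
         [\/ separators_linked G A B, leaf_linked G del A B |
             leaf_linked G del B A])].

Definition cherry_wine (k : nat) (J : cluster_graph) (T : nat -> cluster_graph) :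
    Prop :=
  [/\ T k = J, (forall m, (2 <= m <= k)%N -> descends (T m) (T m.-1)) &
      exists T', regular_vine T' /\ forall m, (1 <= m <= k)%N -> T' m = T m].

End junction_trees.

Section copula_products.
Context d0 (Omega : measurableType d0) (R : realType) (P : probability Omega R).
Context (d : nat) (X : 'I_d -> {RV P >-> R}).
Variable f c : forall D : {set 'I_d}, #|D|.-tuple R -> R.
Variable cc : 'I_d -> 'I_d -> forall S : {set 'I_d}, #|S|.-tuple R -> R -> R -> R.
Implicit Types (x : 'I_d -> R) (J : cluster_graph 'I_d).

Definition tcherry_density J x : R :=
  (\prod_(K in clusters J) marg f K x) /
  (\prod_(S in separators J) marg f S x ^+ (nu J S).-1).

Definition tcherry_copula_density J x : R :=
  (\prod_(K in clusters J) c (coords K (cdfs X x))) /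
  (\prod_(S in separators J) c (coords S (cdfs X x)) ^+ (nu J S).-1).

(* Each unordered pair of linked clusters is met in both orders; the conditions
   l < m and a < b keep exactly one of them. *)
Definition cherry_wine_copula_density (k : nat) (T : nat -> cluster_graph 'I_d) x
    : R :=
  (\prod_(l : 'I_d) \prod_(m : 'I_d | (l < m)%N && link (T 1%N) [set l] [set m])
     c (coords [set l; m] (cdfs X x))) *
  \prod_(2 <= i < k) \prod_(e in clusters (T i))
    \prod_(e' in clusters (T i) | link (T i) e e')
    \prod_(a in e :\: e') \prod_(b in e' :\: e | (a < b)%N)
      cc a b (coords (e :&: e') x) (cond_cdf f a (e :&: e') x)
        (cond_cdf f b (e :&: e') x).

End copula_products.

(* Main.v *)
Require Import Defs.
From mathcomp Require Import all_boot all_order all_algebra.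
From mathcomp Require Import all_classical all_reals all_analysis.
From mathcomp Require Import ring.

Set Implicit Arguments.
Unset Strict Implicit.
Unset Printing Implicit Defensive.

Local Open Scope ring_scope.

(** Fix a point x and write [w D] for the copula density c_D at u_D, so that
    f_D is [w D] times the product of the f_i over i in D. The second factor
    is modular in D. Hence, for linked clusters e and e' of T_i with
    S = e :&: e', the conditional copula density f_{ab|S} / (f_{a|S} f_{b|S})
    involves [w] alone and equals
      w (e :|: e') * w (e :&: e') / (w e * w e').
    Both sides of the claim are thus expressions in [w], and the identity
    between them holds for every nowhere vanishing weight [w] that is 1 on
    singletons.

    Let [junction_weight w (T m)] be the product of [w] over the clusters of
    T_m divided by the product of [w S ^+ (nu S - 1)] over its separators.
    The ratio of two consecutive junction weights is the product of the
    expressions above over the links of T_m ([junction_weight_step]), so the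
    cherry-wine product telescopes to the junction weight of T_k
    ([vine_product]). Three facts give this ratio.
    - Unions of linked clusters: a cluster of T_m inside the union of two
      linked ones is one of the two, by the running intersection property
      ([cluster_sub_link]). Distinct links therefore have distinct unions, and
      the links of T_m correspond to the clusters of T_{m+1}
      ([prod_link_union]).
    - Intersections: the clusters of T_m containing S form a subtree, which has
      one link less than clusters, and each of these links has intersection S
      as all separators have the same size. So S is met [nu S - 1] times
      ([count_links_on_separator]).
    - End points: a cluster K of T_m belongs to as many links as there are
      clusters of T_{m+1} containing it, which are more than one exactly when
      K is a separator of T_{m+1}. So the product over end points is the
      product over the clusters of T_m times the product of
      [w S ^+ (nu S - 1)] over the separators of T_{m+1} ([prod_degree]).

    All divisions are legitimate at almost every x with f_V(x) > 0, because
    all marginal densities are positive there: X_D falls in the zero set of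
    f_D with probability 0 ([ae_marg_gt0]). *)

Section Combinatorics.
(* Names such as set0 and subsetP refer to finite sets, not to classical ones. *)
Import boot.fintype boot.finset boot.path boot.fingraph.
Local Open Scope nat_scope.

(** * Counting the edges of a tree *)

Definition orients (T : finType) (o e : rel T) : Prop :=
  (forall x y, e x y = o x y || o y x) /\ (forall x y, o x y -> ~~ o y x).

Definition restrict (T : finType) (e : rel T) (A : {set T}) : rel T :=
  fun x y => [&& e x y, x \in A & y \in A].

(** A maximal connected part [B] of [A] with one edge less than vertices is all
    of [A]: otherwise connectedness gives an edge from some [u] in [B] to some
    [y] in [A] outside [B], and adding [y] adds exactly one edge, as a second
    neighbour of [y] in [B] would close a cycle through [B]. *)
Lemma card_oriented_edges (T : finType) (e o : rel T) (A : {set T}) :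
    symmetric e -> orients o e ->
    (forall p, ucycle e p -> size p <= 2)%N -> A != set0 ->
    {in A &, forall x y, connect (restrict e A) x y} ->
  #|[set p : T * T | [&& o p.1 p.2, p.1 \in A & p.2 \in A]]|.+1 = #|A|.
Proof.
move=> es [eo oo] acyc /set0Pn[r rA] conA.
pose edges (B : {set T}) := 
  [set p : T * T | [&& o p.1 p.2, p.1 \in B & p.2 \in B]].
pose conn (B : {set T}) := [forall x in B, connect (restrict e B) r x].
pose grown := [pred B : {set T} |
  [&& B \subset A, r \in B, conn B & #|edges B|.+1 == #|B|]].
have o_irr x : o x x = false.
  by apply/negP => oxx; move: (oo _ _ oxx); rewrite oxx.
have g1 : grown [set r].
  rewrite /= sub1set rA set11 /= cards1 eqSS; apply/andP; split.
    by apply/forall_inP => x /set1P->; exact: connect0.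
  rewrite cards_eq0; apply/eqP/setP => -[x y]; rewrite !inE /=.
  by apply/negP => /and3P[oxy /eqP xr /eqP yr]; rewrite xr yr o_irr in oxy.
have [B /maxsetP[/and4P[BA rB /forall_inP cB /eqP nB] maxB] _] :=
  maxset_exists g1.
rewrite -/(edges A); suff -> : A = B by [].
apply/eqP; rewrite eqEsubset BA andbT; apply/subsetP => z zA.
apply/negPn/negP => zB.
have rsym (C : {set T}) : symmetric (restrict e C).
  by move=> x y; rewrite /restrict es [(y \in C) && _]andbC.
have [u [y [uB yB euy yA]]] : exists u y,
    [/\ u \in B, y \notin B, e u y & y \in A].
  have [/existsP[u /existsP[y /and4P[? ? ? ?]]]|none] :=
    boolP [exists u, exists y, [&& u \in B, y \notin B, e u y & y \in A]].
    by exists u, y.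
  suff cl : closed (restrict e A) (mem B).
    by move: (closed_connect cl (conA _ _ rA zA)); rewrite /= rB (negbTE zB).
  apply: (intro_closed (sym_connect_sym (rsym A))) => x y /and3P[exy xA yA] xB.
  apply: contraNT none => yB; apply/existsP; exists x; apply/existsP; exists y.
  exact/and4P.
(* Two neighbours of y in B would be the ends of a path in B, hence of a cycle. *)
have nbr v : v \in B -> e v y -> v = u.
  move=> vB evy; apply/eqP/negPn/negP => vu.
  have : connect (restrict e B) u v.
    apply: (connect_trans (y := r)); last exact: cB.
    by rewrite (sym_connect_sym (rsym B)); exact: cB.
  move=> /connectP[p pp vp]; move: pp vp => /shortenP[q qp uq _] vp.
  have qB : all (mem B) q.
    elim: (q) (u) qp {uq vp} => //= a s IH b /andP[/and3P[_ _ aB] /IH ->].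
    by rewrite aB.
  have qe : path e u q by apply: sub_path qp => a b /and3P[].
  have : (size (y :: u :: q) <= 2)%N.
    apply: acyc; apply/andP; split.
      by rewrite /= es euy /= rcons_path qe -vp.
    rewrite /= in uq *; rewrite uq andbT inE negb_or.
    apply/andP; split; first by apply: contraNneq yB => ->.
    by apply: contraNN yB => /(allP qB).
  by case: q vp {qp uq qB qe} => //= vp; rewrite vp eqxx in vu.
have : grown (y |: B).
  rewrite /= subUset sub1set yA BA !inE rB orbT /=; apply/andP; split.
    have sub : subrel (connect (restrict e B)) (connect (restrict e (y |: B))).
      apply: connect_sub => a b /and3P[eab aB bB]; apply: connect1.
      by rewrite /restrict eab !inE aB bB !orbT.
    apply/forall_inP => x /setU1P[->|xB]; last by apply: sub; exact: cB.
    apply: (connect_trans (y := u)); first by apply: sub; exact: cB.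
    by apply: connect1; rewrite /restrict euy !inE uB eqxx orbT.
  rewrite cardsU1 yB add1n -nB eqSS.
  pose q := if o u y then (u, y) else (y, u).
  have -> : edges (y |: B) = q |: edges B.
    apply/setP => -[a b]; rewrite !inE /=.
    have -> : ((a, b) == q) =
        o a b && ((a == u) && (b == y) || (a == y) && (b == u)).
      rewrite /q; case: ifP => ouy; rewrite xpair_eqE; apply/idP/idP.
      - by move=> /andP[/eqP-> /eqP->]; rewrite ouy !eqxx.
      - by move=> /andP[oab /orP[//|/andP[/eqP ay /eqP bu]]];
          rewrite ay bu (negbTE (oo _ _ ouy)) in oab.
      - move=> /andP[/eqP-> /eqP->]; move: euy; rewrite eo ouy /= => ->.
        by rewrite !eqxx orbT.
      - move=> /andP[oab /orP[/andP[/eqP au /eqP bu]|//]].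
        by rewrite au bu ouy in oab.
    case oab: (o a b) => //=.
    have eab : e a b by rewrite eo oab.
    apply/idP/idP => [/andP[/predU1P[ay|aB] /predU1P[yb|bB]]|].
    - by rewrite ay yb o_irr in oab.
    - by rewrite [b](nbr _ bB) ?ay ?eqxx ?orbT // es -ay.
    - by rewrite [a](nbr _ aB) ?yb ?eqxx // -yb.
    - by rewrite aB bB orbT.
    - by move=> /orP[/orP[]|] /andP[];
        [move=> /eqP-> /eqP->|move=> /eqP-> /eqP->|move=> -> ->];
        rewrite ?eqxx ?uB ?orbT.
  rewrite cardsU1 inE /q; case: ifP => _; by rewrite /= (negbTE yB) ?andbF.
move=> /maxB/(_ (subsetUr _ _)) yBB.
by move: yB; rewrite -yBB setU11.
Qed.

(** * Junction trees with clusters of equal size *)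

(** What the argument uses of an order-[m] junction tree; it also covers the
    first tree of a vine, with singleton clusters. *)
Definition uniform_tree (V : finType) (m : nat) (G : cluster_graph V) : Prop :=
  [/\ is_tree G, running_intersection G &
      {in clusters G, forall K : {set V}, #|K| = m}].

Definition edge_clusters (V : finType) (G G' : cluster_graph V) : Prop :=
  clusters G' =
    [set K :|: K' | K in clusters G, K' in clusters G & link G K K'].

Section ClusterTrees.
Variables (V : finType) (m : nat) (G : cluster_graph V).
Hypothesis uG : uniform_tree m G.
Implicit Types (K e g S : {set V}).

Lemma linkC K K' : link G K K' = link G K' K.
Proof. by case: uG => -[_ _ [_ ls] _ _] _ _; exact: ls. Qed.

Lemma link_clusters K K' : link G K K' -> K \in clusters G /\ K' \in clusters G.
Proof. by case: uG => -[_ lc _ _ _] _ _; exact: lc. Qed.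

Lemma link_neq K K' : link G K K' -> K != K'.
Proof.
by case: uG => -[_ _ [li _] _ _] _ _; apply: contraTneq => ->; rewrite li.
Qed.

Lemma card_cluster K : K \in clusters G -> #|K| = m.
Proof. by case: uG => _ _ cG; exact: cG. Qed.

Lemma cluster_eq K K' : K \in clusters G -> K' \in clusters G ->
  K \subset K' -> K = K'.
Proof.
move=> KG K'G KK'; apply/eqP.
by rewrite eqEcard KK' (card_cluster KG) (card_cluster K'G) leqnn.
Qed.

Lemma simple_path K K' : K \in clusters G -> K' \in clusters G ->
  exists p, [/\ path (link G) K p, uniq (K :: p) & last K p = K'].
Proof.
case: uG => -[_ _ _ cn _] _ _ KG K'G.
have /connectP[p pp ->] := cn _ _ KG K'G.
by case/shortenP: pp => q; exists q.
Qed.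

(** A simple path leaves [K] and reaches one end of the link through the other
    end, say [g'] through [g]. Running intersection puts [K :&: g'] inside [g],
    so [K], which is covered by [g :|: g'], is inside [g], and equal to it by
    size. *)
Lemma cluster_sub_link e e' K : link G e e' -> K \in clusters G ->
  K \subset e :|: e' -> K = e \/ K = e'.
Proof.
case: uG => _ rip _ ee' KG Ku.
have [eG e'G] := link_clusters ee'.
have key g g' p : K \subset g :|: g' -> g \in clusters G ->
    path (link G) K (rcons p g') -> uniq (K :: rcons p g') ->
    g \in K :: p -> K = g.
  move=> Kg gG pp up gp; apply: cluster_eq => //; apply/subsetP => v vK.
  have /setUP[//|vg'] := subsetP Kg v vK.
  move: gp; rewrite inE => /predU1P[->//|gp].
  apply: (rip K (rcons p g') v) => //; first by rewrite last_rcons.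
  by rewrite mem_rcons inE gp orbT.
have [p [pp up lp]] := simple_path KG eG.
case: (boolP (e' \in K :: p)) => [e'p|e'p].
  case: (lastP p) lp pp up e'p => [/= -> _ _ _|q b]; first by left.
  rewrite last_rcons => -> pp up.
  rewrite -rcons_cons mem_rcons inE => /predU1P[e'e|e'q]; last first.
    by right; apply: (key e' e q); rewrite // setUC.
  by move: (link_neq ee'); rewrite e'e eqxx.
left; apply: (key e e' p) => //.
- by rewrite rcons_path pp lp.
- by rewrite -rcons_cons rcons_uniq e'p.
- by rewrite -lp mem_last.
Qed.

Lemma link_union_inj e e' g g' : link G e e' -> link G g g' ->
  e :|: e' = g :|: g' -> (e, e') = (g, g') \/ (e, e') = (g', g).
Proof.
move=> ee' gg' eg; have [eG e'G] := link_clusters ee'.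
have := cluster_sub_link gg' eG; have := cluster_sub_link gg' e'G.
rewrite -eg subsetUl subsetUr => /(_ isT) + /(_ isT).
by case=> e'E; case=> eE; move: (link_neq ee');
  rewrite {}eE {}e'E ?eqxx // => _; [right|left].
Qed.

(** Running intersection: every cluster on the path contains [S]. *)
Lemma connected_through S K K' : K \in clusters G -> K' \in clusters G ->
    S \subset K -> S \subset K' ->
  connect (restrict (link G) [set K in clusters G | S \subset K]) K K'.
Proof.
case: uG => _ rip _ KG K'G SK SK'.
have [p [pp up lp]] := simple_path KG K'G.
have Sp : all (fun C => (C \in clusters G) && (S \subset C)) (K :: p).
  apply/allP => C Cp; apply/andP; split.
    move: Cp; rewrite inE => /predU1P[->//|].
    elim: (p) (K) pp {up lp} => //= a s IH b /andP[/link_clusters[_ aG] /IH{}IH].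
    by rewrite inE => /predU1P[->//|/IH].
  apply/subsetP => v vS; move: Cp; rewrite inE => /predU1P[->|Cp].
    exact: (subsetP SK).
  apply: (rip K p v) => //; first exact: (subsetP SK).
  by rewrite lp; exact: (subsetP SK').
apply/connectP; exists p => //.
elim: (p) (K) pp Sp {up lp} => //= a s IH b /andP[ba pa] /and3P[bS aS sS].
by rewrite /restrict ba !inE bS aS IH //= aS.
Qed.

(** The clusters containing [S] form a tree with [nu G S] nodes. By size, its
    edges are the links whose intersection is exactly [S]. *)
Lemma count_links_on_separator (o : rel {set V}) S : orients o (link G) ->
    (forall K K', link G K K' -> #|K :&: K'| = #|S|) ->
    S \in separators G ->
  #|[set p : {set V} * {set V} | o p.1 p.2 & p.1 :&: p.2 == S]| = (nu G S).-1.
Proof.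
move=> oG cS /imset2P[K K' KG]; rewrite inE => /andP[K'G KK'] SK.
pose A := [set K in clusters G | S \subset K].
have KA : K \in A by rewrite inE KG SK subsetIl.
have <- : #|[set p : {set V} * {set V} |
    [&& o p.1 p.2, p.1 \in A & p.2 \in A]]|.+1 = nu G S.
  apply: (card_oriented_edges (e := link G)) => //.
  - exact: linkC.
  - by case: uG => -[].
  - by apply/set0Pn; exists K.
  - by move=> L L' /setIdP[? ?] /setIdP[? ?]; exact: connected_through.
rewrite /=; apply: eq_card => -[L L']; rewrite !inE /=.
case oL : (o L L') => //=.
have lL : link G L L' by case: oG => -> _; rewrite oL.
have [-> ->] := link_clusters lL; rewrite /= -subsetI.
by rewrite eq_sym eqEcard (cS _ _ lL) leqnn andbT.
Qed.

Variable G' : cluster_graph V.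
Hypothesis eG' : edge_clusters G G'.

Lemma edge_clusterP C :
  reflect (exists K K', link G K K' /\ C = K :|: K') (C \in clusters G').
Proof.
rewrite eG'; apply: (iffP imset2P) => [[K K' _]|[K [K' [KK' ->]]]].
  by rewrite inE => /andP[_ KK'] ->; exists K, K'.
by have [KG K'G] := link_clusters KK'; exists K K'; rewrite ?inE ?K'G.
Qed.

(** By [cluster_sub_link], a union of two linked clusters contains [K] only if
    [K] is one of the two. *)
Lemma nu_edge_clusters K : K \in clusters G ->
  nu G' K = #|[set K' | link G K K']|.
Proof.
move=> KG; rewrite /nu.
have -> : [set C in clusters G' | K \subset C] =
          [set K :|: K' | K' in [set K' | link G K K']].
  apply/setP => C; rewrite inE; apply/andP/imsetP.
    move=> [/edge_clusterP[e [e' [ee' ->]]] Ke].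
    have [->|->] := cluster_sub_link ee' KG Ke.
      by exists e'; rewrite ?inE.
    by exists e; rewrite ?inE 1?linkC // setUC.
  move=> [K' KK' ->]; rewrite inE in KK'.
  by split; [apply/edge_clusterP; exists K, K'|exact: subsetUl].
rewrite card_in_imset // => K1 K2; rewrite !inE => K1K K2K.
by move=> /(link_union_inj K1K K2K)[[]|[-> ->]].
Qed.

End ClusterTrees.

(** * Two consecutive trees of a vine *)

Section ConsecutiveTrees.
Variables (V : finType) (m : nat) (G G' : cluster_graph V).
Hypotheses (uG : uniform_tree m G) (uG' : uniform_tree m.+1 G').
Hypothesis eG' : edge_clusters G G'.
Hypothesis sG' : forall e e', link G' e e' -> share_node G e e'.
Implicit Types (K e S : {set V}).

(** Linked clusters of [G'] share a node of [G], which fills their intersection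
    since the latter has at most [m] elements. *)
Lemma link_inter e e' : link G' e e' -> e :&: e' \in clusters G.
Proof.
move=> ee'; have [N [K [K' [NK NK' eE e'E]]]] := sG' ee'.
have [NG _] := link_clusters uG NK; have [eG e'G] := link_clusters uG' ee'.
suff -> : e :&: e' = N by [].
apply/esym/eqP; rewrite eqEcard subsetI {1}eE {1}e'E !subsetUl /=.
rewrite (card_cluster uG NG) -ltnS -(card_cluster uG' eG).
apply: proper_card; rewrite properEneq subsetIl andbT.
apply: contraNneq (link_neq uG' ee') => /setIidPl ee.
by apply/eqP; apply: (cluster_eq uG').
Qed.

Lemma card_link_inter e e' : link G' e e' -> #|e :&: e'| = m.
Proof. by move=> /link_inter/(card_cluster uG). Qed.

Lemma separators_sub : separators G' \subset clusters G.
Proof.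
apply/subsetP => S /imset2P[e e' _]; rewrite inE => /andP[_ ee'] ->.
exact: link_inter.
Qed.

Lemma nu_gt0 K : K \in clusters G -> 0 < nu G' K.
Proof.
move=> KG; rewrite (nu_edge_clusters uG eG' KG).
have [-[/set0Pn[C CG'] _ _ _ _] _ _] := uG'.
have [e [e' [ee' _]]] := edge_clusterP uG eG' C CG'.
have [eG _] := link_clusters uG ee'.
apply/card_gt0P; have [[|b p] [/= pp _ lp]] := simple_path uG KG eG.
  by exists e'; rewrite inE lp.
by case/andP: pp => Kb _; exists b; rewrite inE.
Qed.

(** Two clusters of [G'] containing [K] are joined by a path of such clusters,
    whose first link has intersection [K]. *)
Lemma nu_nonseparator K : K \in clusters G -> K \notin separators G' ->
  nu G' K = 1.
Proof.
move=> KG KS; apply/eqP; rewrite eqn_leq nu_gt0 // andbT leqNgt.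
apply: contraNN KS => /card_gt1P[L [L' []]].
move=> /setIdP[LG KL] /setIdP[L'G KL'] LL'.
have /connectP[[|L1 p] /= pp lp] := connected_through uG' LG L'G KL KL'.
  by rewrite lp eqxx in LL'.
move: pp => /andP[/and3P[LL1 _ /setIdP[L1G KL1]] _].
have -> : K = L :&: L1.
  by apply: (cluster_eq uG KG (link_inter LL1)); rewrite subsetI KL.
by apply/imset2P; exists L L1; rewrite ?inE ?L1G.
Qed.

End ConsecutiveTrees.

(** * Products of a weight over the links of a tree *)

Section LinkProducts.
Local Open Scope ring_scope.
Import GRing.Theory.
Variables (V : finType) (m : nat) (G : cluster_graph V) (o : rel {set V}).
Hypotheses (uG : uniform_tree m G) (oG : orients o (link G)).
Variables (F : fieldType) (w : {set V} -> F).
Implicit Types (K e S : {set V}).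

Definition junction_weight (H : cluster_graph V) : F :=
  (\prod_(K in clusters H) w K) /
  (\prod_(S in separators H) w S ^+ (nu H S).-1).

Lemma oriented_link e e' : o e e' -> link G e e'.
Proof. by case: oG => -> _ ->. Qed.

Lemma prod_link_inter :
    (forall K K', link G K K' -> #|K :&: K'| = m.-1) ->
  \prod_(p : {set V} * {set V} | o p.1 p.2) w (p.1 :&: p.2) =
  \prod_(S in separators G) w S ^+ (nu G S).-1.
Proof.
move=> cI; have sI p : o p.1 p.2 -> p.1 :&: p.2 \in separators G.
  move=> /oriented_link l; have [pG p'G] := link_clusters uG l.
  by apply/imset2P; exists p.1 p.2; rewrite ?inE ?p'G.
rewrite (partition_big (fun p => p.1 :&: p.2) (mem (separators G))) //=.
apply: eq_bigr => S SG.
rewrite -(count_links_on_separator uG oG _ SG); last first.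
  move=> K K' KK'; case/imset2P: SG => L L' _; rewrite inE => /andP[_ LL'] ->.
  by rewrite !cI.
rewrite -prodr_const; apply: eq_big => [p|p /andP[_ /eqP->]//].
by rewrite inE.
Qed.

Lemma prod_link_ends :
  \prod_(p : {set V} * {set V} | o p.1 p.2) (w p.1 * w p.2) =
  \prod_(K in clusters G) w K ^+ #|[set K' | link G K K']|.
Proof.
have [oe oo] := oG.
rewrite big_split /=.
rewrite -(pair_big_dep predT o (fun e _ => w e)) /=.
rewrite -(pair_big_dep predT o (fun _ e' => w e')) /=.
rewrite [X in _ * X](exchange_big_dep predT) //= -big_split /=.
rewrite [RHS]big_mkcond /=; apply: eq_bigr => K _.
have dE : #|[set K' | link G K K']| =
    (#|[pred x | o K x]| + #|[pred x | o x K]|)%N.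
  rewrite -cardUI [X in _ = (_ + X)%N]eq_card0 ?[RHS]addn0 => [|x].
    by apply: eq_card => x; rewrite !inE oe.
  by rewrite !inE; apply/negP => /andP[/oo/negP].
rewrite !prodr_const -exprD -dE.
case: ifPn => // KG; rewrite (_ : [set K' | _] = set0) ?cards0 //.
apply/setP => x; rewrite !inE; apply: contraNF KG => l.
by case: (link_clusters uG l).
Qed.

Variable G' : cluster_graph V.
Hypothesis eG' : edge_clusters G G'.

Lemma prod_link_union :
  \prod_(p : {set V} * {set V} | o p.1 p.2) w (p.1 :|: p.2) =
  \prod_(K in clusters G') w K.
Proof.
have [oe oo] := oG.
have -> : clusters G' =
    [set p.1 :|: p.2 | p in [set p : {set V} * {set V} | o p.1 p.2]].
  apply/setP => C; apply/(edge_clusterP uG eG')/imsetP.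
    move=> [e [e' [ee' ->]]]; move: (ee'); rewrite oe => /orP[oee|oee].
      by exists (e, e'); rewrite ?inE.
    by exists (e', e); rewrite ?inE // setUC.
  by move=> [[e e']]; rewrite inE /= => /oriented_link ? ->; exists e, e'.
rewrite big_imset /=; first by apply: eq_bigl => p; rewrite inE.
move=> [e e'] [g g']; rewrite !inE /= => oee ogg.
move=> /(link_union_inj uG (oriented_link oee) (oriented_link ogg)).
by case=> // -[eg e'g']; move: (oo _ _ ogg); rewrite -eg -e'g' oee.
Qed.

Hypothesis uG' : uniform_tree m.+1 G'.
Hypothesis sG' : forall e e', link G' e e' -> share_node G e e'.

(** The degree of [K] is [nu G' K]; one factor [w K] is set apart, and the
    remaining exponent [nu G' K - 1] vanishes unless [K] separates [G']. *)
Lemma prod_degree :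
  \prod_(K in clusters G) w K ^+ #|[set K' | link G K K']| =
  (\prod_(K in clusters G) w K) *
  (\prod_(S in separators G') w S ^+ (nu G' S).-1).
Proof.
rewrite [X in _ * X](_ : _ = \prod_(K in clusters G) w K ^+ (nu G' K).-1).
  rewrite -big_split; apply: eq_bigr => K KG /=.
  by rewrite -(nu_edge_clusters uG eG' KG) -exprS prednK // (nu_gt0 uG uG').
rewrite [RHS](big_setID (separators G')) /= (setIidPr _).
  by rewrite [X in _ * X]big1 ?mulr1 // => K /setDP[KG KS];
    rewrite (nu_nonseparator uG uG' eG' sG' KG KS).
exact: (separators_sub uG uG' sG').
Qed.

Lemma junction_weight_step :
    (forall K, w K != 0) ->
    (forall K K', link G K K' -> #|K :&: K'| = m.-1) ->
  junction_weight G' = junction_weight G *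
    \prod_(p : {set V} * {set V} | o p.1 p.2)
      (w (p.1 :|: p.2) * w (p.1 :&: p.2) / (w p.1 * w p.2)).
Proof.
move=> w0 cI.
rewrite prodf_div big_split /= prod_link_union prod_link_inter // prod_link_ends.
rewrite prod_degree /junction_weight.
have nz (I : finType) (A : pred I) (h : I -> {set V}) (n : I -> nat) :
    \prod_(i | A i) w (h i) ^+ n i != 0.
  by apply/prodf_neq0 => i _; rewrite expf_neq0.
set a := \prod_(K in clusters G') _; set b := \prod_(S in separators G') _.
set a1 := \prod_(K in clusters G) _; set b1 := \prod_(S in separators G) _.
have b10 : b1 != 0 by exact: (nz _ _ id).
have a10 : a1 != 0 by apply/prodf_neq0.
have b0 : b != 0 by exact: (nz _ _ id).
rewrite invfM !mulrA [a1 / b1]mulrC.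
by rewrite -[_ * a1 * a]mulrA; field; rewrite a10 b10 b0.
Qed.

End LinkProducts.

(** * The telescoping product along a regular vine *)

Section RegularVine.
Variables (d : nat) (T : nat -> cluster_graph 'I_d).
Hypothesis vT : regular_vine T.

Lemma vine_uniform m : 0 < m < d -> uniform_tree m (T m).
Proof.
have [tT1 cT1 vTm] := vT; case: m => [//|[_|m md]]; last first.
  have [|[[tT _ _ rT] _] _ _ cT _] := vTm m.+2; first by rewrite card_ord.
  by split.
have sing K : K \in clusters (T 1) -> exists v, K = [set v].
  by rewrite cT1 => /imsetP[v _ ->]; exists v.
split=> // [K p v KT pp up vK|K /sing[v ->]]; last exact: cards1.
case: tT1 => _ lT _ _ _.
case/lastP: p pp up => [|p L] //; rewrite rcons_path => /andP[_ /lT[_ LT]].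
rewrite -rcons_cons rcons_uniq last_rcons inE negb_or => /andP[/andP[LK _] _].
have [[x Kx] [y Ly]] := (sing _ KT, sing _ LT).
move: LK vK; rewrite {}Kx {}Ly !inE => xy /eqP-> /eqP xy'.
by rewrite xy' eqxx in xy.
Qed.

Lemma vine_edge_clusters m : 0 < m -> m.+1 < d ->
  edge_clusters (T m) (T m.+1).
Proof.
move=> m0 md; have [_ _ vTm] := vT.
by case: (vTm m.+1) => //; rewrite card_ord ltnS m0.
Qed.

Lemma vine_share_node m e e' : 0 < m -> m.+1 < d ->
  link (T m.+1) e e' -> share_node (T m) e e'.
Proof.
move=> m0 md; have [_ _ vTm] := vT.
by case: (vTm m.+1) => [|_ _ _ _]; [rewrite card_ord ltnS m0|exact].
Qed.

Lemma vine_link_inter m e e' : 0 < m < d -> link (T m) e e' ->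
  #|e :&: e'| = m.-1.
Proof.
move=> md ee'; have uT := vine_uniform md.
case: m md ee' uT => [//|[|m]] md ee' uT; last first.
  have uT' : uniform_tree m.+1 (T m.+1) by apply: vine_uniform; exact: ltnW.
  by apply: (card_link_inter uT' uT _ ee') => ? ?; exact: vine_share_node.
have [eT e'T] := link_clusters uT ee'.
apply/eqP; rewrite cards_eq0 setI_eq0.
have [_ cT1 _] := vT; move: eT e'T (link_neq uT ee').
rewrite cT1 => /imsetP[x _ ->] /imsetP[y _ ->] xy.
by rewrite disjoints1 inE; apply: contraNneq xy => ->.
Qed.

(** The direction in which a product restricted to a < b meets a link. *)
Definition index_link (G : cluster_graph 'I_d) : rel {set 'I_d} := fun e e' =>
  link G e e' && [exists a in e :\: e', [exists b in e' :\: e, a < b]].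

Lemma link_diff m e e' : 0 < m < d -> link (T m) e e' ->
  exists a b, [/\ e :\: e' = [set a], e' :\: e = [set b] & a != b].
Proof.
move=> md ee'; have uT := vine_uniform md.
have [eT e'T] := link_clusters uT ee'.
have cI := vine_link_inter md ee'.
have /cards1P[a ea] : #|e :\: e'| == 1.
  rewrite cardsD cI (card_cluster uT eT).
  by case: (m) md => // n _; rewrite subSnn.
have /cards1P[b eb] : #|e' :\: e| == 1.
  rewrite cardsD setIC cI (card_cluster uT e'T).
  by case: (m) md => // n _; rewrite subSnn.
exists a, b; split => //; apply: contraTneq (set11 a) => ab.
have /setDP[_] : b \in e' :\: e by rewrite eb set11.
by rewrite -ab -ea inE => /negPf ->; rewrite andbF.
Qed.

Lemma index_linkE m e e' a b : link (T m) e e' ->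
  e :\: e' = [set a] -> e' :\: e = [set b] -> index_link (T m) e e' = (a < b).
Proof.
move=> ee' ea eb; rewrite /index_link ee' /=; apply/exists_inP/idP.
  rewrite ea => -[x /set1P->] /exists_inP[y].
  by rewrite eb => /set1P->.
move=> ab; exists a; first by rewrite ea set11.
by apply/exists_inP; exists b; rewrite ?eb ?set11.
Qed.

Lemma index_link_orients m : 0 < m < d ->
  orients (index_link (T m)) (link (T m)).
Proof.
move=> md; have uT := vine_uniform md; split=> e e'.
  case ee' : (link (T m) e e'); last by rewrite /index_link (linkC uT e') ee'.
  have [a [b [ea eb ab]]] := link_diff md ee'.
  rewrite (index_linkE ee' ea eb) (index_linkE _ eb ea);
    last by rewrite (linkC uT).
  by rewrite -neq_ltn.
move=> oe; have /andP[ee' _] := oe.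
have [a [b [ea eb ab]]] := link_diff md ee'.
rewrite (index_linkE _ eb ea); last by rewrite (linkC uT).
by move: oe; rewrite (index_linkE ee' ea eb) -leqNgt => /ltnW.
Qed.

Section VineProducts.
Local Open Scope ring_scope.
Import GRing.Theory.
Variables (F : fieldType) (w : {set 'I_d} -> F).
Variable h : 'I_d -> 'I_d -> {set 'I_d} -> F.
Hypothesis w_neq0 : forall K, w K != 0.
Hypothesis w1 : forall v, w [set v] = 1.
Hypothesis hE : forall (a b : 'I_d) (S : {set 'I_d}),
  a != b -> a \notin S -> b \notin S ->
  h a b S = w ([set a; b] :|: S) * w S / (w (a |: S) * w (b |: S)).

(** The separators of [T 2] are singletons, of weight 1, and its clusters are
    the edges of [T 1]. *)
Lemma first_tree_product : (2 < d)%N ->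
  \prod_(l : 'I_d) \prod_(m : 'I_d | (l < m)%N && link (T 1%N) [set l] [set m])
     w [set l; m] = junction_weight w (T 2%N).
Proof.
move=> d2; have [_ cT1 _] := vT.
have u1 : uniform_tree 1 (T 1%N) by apply: vine_uniform; exact: ltnW.
have e12 : edge_clusters (T 1%N) (T 2%N) by apply: vine_edge_clusters.
have o1 : orients (index_link (T 1%N)) (link (T 1%N)).
  by apply: index_link_orients; exact: ltnW.
rewrite /junction_weight [X in _ / X]big1 ?divr1 => [|S].
  rewrite -(prod_link_union u1 o1 w e12) pair_big_dep /=.
  pose g (q : 'I_d * 'I_d) := ([set q.1], [set q.2]).
  have linkE x y : index_link (T 1%N) [set x] [set y] =
      ((x < y)%N && link (T 1%N) [set x] [set y]).
    case xy : (link (T 1%N) [set x] [set y]);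
      last by rewrite andbF /index_link xy.
    have dxy : x != y by apply: contraTneq (link_neq u1 xy) => ->; rewrite eqxx.
    rewrite andbT; apply: (index_linkE xy); apply/setP => z; rewrite !inE.
      by case: (z =P x) => [->|_]; rewrite ?andbF // dxy.
    by case: (z =P y) => [->|_]; rewrite ?andbF // eq_sym dxy.
  rewrite (eq_bigl (fun p => p \in [set g q | q : 'I_d * 'I_d &
      index_link (T 1%N) [set q.1] [set q.2]])) /=; last first.
    move=> [e e'] /=; apply/idP/imsetP => [oe|[[x y]]].
      have [eT e'T] := link_clusters u1 (oriented_link o1 oe).
      move: eT e'T oe; rewrite cT1 => /imsetP[x _ ->] /imsetP[y _ ->] oe.
      by exists (x, y); rewrite ?inE.
    by rewrite inE /= => oxy [-> ->].
  rewrite big_imset /=; first by apply: eq_bigl => q; rewrite inE linkE.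
  by move=> [x y] [x' y'] _ _ [] /set1_inj -> /set1_inj ->.
move=> SS; have : S \in clusters (T 1%N).
  apply: (subsetP (separators_sub u1 (vine_uniform _) _) S SS); first by [].
  by move=> e e'; exact: vine_share_node.
by rewrite cT1 => /imsetP[v _ ->]; rewrite w1 expr1n.
Qed.

Lemma prod_set1_pair (I : finType) (x y : I) (P : rel I) (f : I -> I -> F) :
  \prod_(i in [set x]) \prod_(j in [set y] | P i j) f i j =
  if P x y then f x y else 1.
Proof. by rewrite big_set1 big_mkcondr big_set1. Qed.

Lemma tree_product i : (0 < i < d)%N ->
  \prod_(e in clusters (T i)) \prod_(e' in clusters (T i) | link (T i) e e')
    \prod_(a in e :\: e') \prod_(b in e' :\: e | (a < b)%N) h a b (e :&: e') =
  \prod_(p : {set 'I_d} * {set 'I_d} | index_link (T i) p.1 p.2)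
    (w (p.1 :|: p.2) * w (p.1 :&: p.2) / (w p.1 * w p.2)).
Proof.
move=> id; have uT := vine_uniform id.
rewrite pair_big_dep /= [RHS]big_mkcond [LHS]big_mkcond /=.
apply: eq_bigr => -[e e'] _ /=.
case ee' : (link (T i) e e'); last by rewrite !andbF /index_link ee'.
have [-> ->] := link_clusters uT ee'; rewrite /=.
have [a [b [ea eb ab]]] := link_diff id ee'.
rewrite (index_linkE ee' ea eb) ea eb.
rewrite [LHS](prod_set1_pair a b (fun x y : 'I_d => (x < y)%N)).
case: ifP => // _.
have eS : e = a |: (e :&: e') by rewrite -ea setUC setID.
have e'S : e' = b |: (e :&: e') by rewrite -eb setIC setUC setID.
have [aS bS] : a \notin e :&: e' /\ b \notin e :&: e'.
  have /setDP[_ ae'] : a \in e :\: e' by rewrite ea set11.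
  have /setDP[_ be] : b \in e' :\: e by rewrite eb set11.
  by rewrite !inE (negPf ae') (negPf be) andbF.
rewrite hE // -eS -e'S; congr (w _ * _ / _).
by rewrite [in RHS]eS [in RHS]e'S; apply/setP => z; rewrite !inE;
  do !case: (_ == _) => //=; case: (_ \in _) => //=; case: (_ \in _).
Qed.

(** Induction on [k], each tree contributing the ratio of two consecutive
    junction weights. *)
Lemma vine_product k : (2 <= k < d)%N ->
  (\prod_(l : 'I_d) \prod_(m : 'I_d | (l < m)%N && link (T 1%N) [set l] [set m])
     w [set l; m]) *
  \prod_(2 <= i < k) \prod_(e in clusters (T i))
    \prod_(e' in clusters (T i) | link (T i) e e')
    \prod_(a in e :\: e') \prod_(b in e' :\: e | (a < b)%N) h a b (e :&: e') =
  junction_weight w (T k).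
Proof.
elim: k => [//|k IH] /andP[k2 kd].
move: k2; rewrite leq_eqVlt => /predU1P[k2|k2].
  by rewrite -k2 big_geq // mulr1 first_tree_product // k2.
have k0d : (0 < k < d)%N.
  by rewrite (ltnW kd) andbT (leq_trans _ (k2 : (2 <= k)%N)).
have k0 : (0 < k)%N by case/andP: k0d.
rewrite big_nat_recr //= mulrA IH; last by rewrite -ltnS k2 ltnW.
rewrite tree_product //; apply/esym; apply: junction_weight_step => //.
- exact: vine_uniform.
- exact: index_link_orients.
- exact: vine_edge_clusters.
- exact: vine_uniform.
- by move=> ? ?; exact: vine_share_node.
- by move=> ? ?; exact: vine_link_inter.
Qed.

End VineProducts.
End RegularVine.

End Combinatorics.

(** * Positivity of the marginal densities *)

Section Densities.
Local Open Scope classical_set_scope.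
Import Order.TTheory GRing.Theory Num.Theory.
Context d0 (Omega : measurableType d0) (R : realType) (P : probability Omega R).
Context (d : nat) (X : 'I_d -> {RV P >-> R}).
Variable f : forall D : {set 'I_d}, #|D|.-tuple R -> R.
Implicit Types (D : {set 'I_d}) (x : 'I_d -> R).

Lemma measurable_tcast m n (e : m = n) :
  measurable_fun [set: m.-tuple R] (tcast e : m.-tuple R -> n.-tuple R).
Proof.
case: _ / e; rewrite (_ : tcast _ = id); first exact: measurable_id.
by apply/funext => t; rewrite tcast_id.
Qed.

Lemma ae_tcast m n (e : m = n) (Q : n.-tuple R -> Prop) :
  {ae lebesgue_tuple R n, forall y, Q y} ->
  {ae lebesgue_tuple R m, forall y, Q (tcast e y)}.
Proof.
by case: _ / e Q => Q; apply: filterS => y; rewrite tcast_id.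
Qed.

(* The density of the whole vector lives on tuples of length #|setT|, while
   almost everywhere refers to tuples of length d. *)
Let full_card : d = #|[set: 'I_d]%SET|.
Proof. by rewrite cardsT card_ord. Qed.

Lemma coords_full x :
  coords [set: 'I_d]%SET x = tcast full_card [tuple x i | i < d].
Proof.
apply: eq_from_tnth => j; rewrite tnth_mktuple tcastE tnth_mktuple.
congr (x _); apply: val_inj => /=.
rewrite (enum_val_nth (cast_ord (esym full_card) j)) enum_setT -enumT.
rewrite nth_enum_ord //.
exact: leq_trans (ltn_ord j) (eq_leq (esym full_card)).
Qed.

Lemma measurable_coords D :
  measurable_fun [set: d.-tuple R] (fun t : d.-tuple R => coords D (tnth t)).
Proof.
apply/measurable_fun_tnthP => j.
rewrite (_ : _ \o _ = @tnth _ R ^~ (enum_val j)); first exact: measurable_tnth.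
by apply/funext => t /=; rewrite tnth_mktuple.
Qed.

Hypothesis f_density : forall D, is_density X (@f D).

(** The integral of f_V over the points whose [D]-part lies in the zero set of
    f_D is the probability that X_D lies there, that is, the integral of f_D
    over its own zero set, which is 0. So f_V vanishes almost everywhere on
    these points. *)
Lemma ae_marg_gt0 D : ae_support f (fun x => 0 < marg f D x).
Proof.
have [mD f0 PD] := f_density D; have [mV _ PV] := f_density [set: 'I_d]%SET.
pose Z : set (#|D|.-tuple R) := [set y | f y = 0].
have mZ : measurable Z.
  rewrite (_ : Z = setT `&` @f D @^-1` [set 0]); first exact: mD.
  by rewrite setTI.
pose Z' : set (#|[set: 'I_d]%SET|.-tuple R) :=
  [set y | Z (coords D (tnth (tcast (esym full_card) y)))].
have mZ' : measurable Z'.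
  have mc := measurableT_comp (@measurable_coords D)
    (@measurable_tcast _ _ (esym full_card)).
  by rewrite -[Z']setTI; exact: mc.
have fZ' : (\int[lebesgue_tuple R _]_(y in Z') (f y)%:E = 0)%E.
  rewrite -PV // (_ : [set w | _] = [set w | Z (coords D (fun i => X i w))]).
    by rewrite PD // integral0_eq // => y ->.
  apply/funext => w; rewrite /= /Z' /= coords_full tcastK; congr (Z _).
  by apply: eq_from_tnth => j; rewrite !tnth_mktuple.
have aeZ' : {ae lebesgue_tuple R _, forall y, Z' y -> (f y)%:E = 0%E}.
  apply/(ae_eq_integral_abs _ mZ').
    apply/measurable_realfun.measurable_EFinP.
    by apply: measurable_funS mV.
  rewrite -[RHS]fZ'; apply: eq_integral => y _; rewrite gee0_abs // lee_fin.
  by have [] := f_density [set: 'I_d]%SET.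
apply: filterS (ae_tcast full_card aeZ') => t Zt.
have tE : coords [set: 'I_d]%SET (tnth t) = tcast full_card t.
  rewrite coords_full; congr tcast.
  by apply: eq_from_tnth => j; rewrite tnth_mktuple.
rewrite /marg tE => ft; rewrite lt_neqAle f0 andbT eq_sym; apply/eqP => fD.
by move: ft; rewrite -lte_fin Zt ?ltxx // /Z' /= tcastK.
Qed.
End Densities.

(** * From copula densities to weights *)

Lemma ae_support_forall (R : realType) (d : nat)
    (f : forall D : {set 'I_d}, #|D|.-tuple R -> R)
    (I : finType) (Q : I -> ('I_d -> R) -> Prop) :
  (forall i, ae_support f (Q i)) -> ae_support f (fun x => forall i, Q i x).
Proof.
move=> Qae; have : {ae lebesgue_tuple R d, forall x : d.-tuple R, forall i,
    0 < marg f [set: 'I_d]%SET (tnth x) -> Q i (tnth x)}.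
  exact: filter_forall.
by apply: filterS => x Qx fx i; exact: Qx.
Qed.

Section CopulaFactors.
Import Order.TTheory GRing.Theory Num.Theory.
Import boot.fintype boot.finset.
Context d0 (Omega : measurableType d0) (R : realType) (P : probability Omega R).
Context (d : nat) (X : 'I_d -> {RV P >-> R}).
Variables f c : forall D : {set 'I_d}, #|D|.-tuple R -> R.
Variable x : 'I_d -> R.
Hypothesis f_gt0 : forall D, 0 < marg f D x.
Hypothesis cE : forall D : {set 'I_d},
  marg f D x = c (coords D (cdfs X x)) * \prod_(i in D) marg f [set i] x.
Let w (D : {set 'I_d}) : R := c (coords D (cdfs X x)).

Lemma copula_singleton v : w [set v] = 1.
Proof.
by apply: (mulIf (lt0r_neq0 (f_gt0 [set v]))); rewrite mul1r [RHS]cE big_set1.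
Qed.

Lemma copula_neq0 D : w D != 0.
Proof.
by apply: contraTneq (f_gt0 D) => cD; rewrite cE -/(w D) cD mul0r ltxx.
Qed.

(** The univariate densities cancel: the product over [D] of the f_i takes the
    same value on both sides of the pair (e :|: e', e :&: e') versus (e, e'). *)
Lemma cond_copula_ratio (a b : 'I_d) (S : {set 'I_d}) (r : R) :
    a != b -> a \notin S -> b \notin S ->
    cond_density f [set a; b] S x =
      r * (cond_density f [set a] S x * cond_density f [set b] S x) ->
  r = w ([set a; b] :|: S) * w S / (w (a |: S) * w (b |: S)).
Proof.
move=> ab aS bS; rewrite /cond_density -setUA.
have abS : a \notin b |: S by rewrite !inE negb_or ab.
rewrite !cE -/(w _) -/(w (a |: _)) -/(w (b |: S)) -/(w S).
rewrite (big_setU1 _ abS) (big_setU1 _ aS) (big_setU1 _ bS) /=.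
have := lt0r_neq0 (f_gt0 [set a]); have := lt0r_neq0 (f_gt0 [set b]).
have := copula_neq0 (a |: S); have := copula_neq0 (b |: S); have := copula_neq0 S.
have : \prod_(i in S) marg f [set i] x != 0.
  by apply/prodf_neq0 => i _; rewrite lt0r_neq0.
set pS := \prod_(i in S) _; set wab := w (a |: (b |: S)).
move=> pS0 wS0 wb0 wa0 fb0 fa0 h.
have nz : (w (a |: S) * (marg f [set a] x * pS) / (w S * pS) *
   (w (b |: S) * (marg f [set b] x * pS) / (w S * pS))) != 0.
  by rewrite !(mulf_neq0, invr_eq0).
apply: (mulIf nz); rewrite -h; field.
by rewrite wS0 wb0 wa0 pS0.
Qed.

End CopulaFactors.

Theorem theorem5 (d0 : measure_display) (Omega : measurableType d0)
    (R : realType) (P : probability Omega R) (k d : nat)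
    (X : 'I_d -> {RV P >-> R})
    (f c : forall D : {set 'I_d}, #|D|.-tuple R -> R)
    (cc : 'I_d -> 'I_d -> forall S : {set 'I_d}, #|S|.-tuple R -> R -> R -> R)
    (J : cluster_graph 'I_d) (T : nat -> cluster_graph 'I_d)
    (k_ge2 : (2 <= k)%N) (k_lt_d : (k < d)%N)
    (f_density : forall D : {set 'I_d}, is_density X (@f D))
    (J_tcherry : tcherry_junction_tree k [set: 'I_d] J)
    (f_tcherry : ae_support f (fun x => marg f [set: 'I_d] x = tcherry_density f J x))
    (J_separators : exists L : rel {set 'I_d},
       tcherry_junction_tree k.-1 (finset.cover (separators J))
         (ClusterGraph (separators J) L))
    (T_cherry_wine : cherry_wine k J T)
    (c_copula : forall D : {set 'I_d}, copula_density X f (@c D))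
    (cc_copula : forall (a b : 'I_d) (S : {set 'I_d}),
       a != b -> a \notin S -> b \notin S -> cond_copula_density f a b (@cc a b S)) :
  ae_support f (fun x =>
    tcherry_copula_density X c J x =
    cherry_wine_copula_density X f c cc k T x).
Proof.
have [TkJ _ [T' [vT' T'E]]] := T_cherry_wine.
have pos := ae_support_forall (fun D => ae_marg_gt0 f_density D).
have cop : ae_support f (fun x => forall D : {set 'I_d},
    marg f D x = c D (coords D (cdfs X x)) * \prod_(i in D) marg f [set i]%SET x).
  by apply: ae_support_forall => D; case: (c_copula D).
have ccop : ae_support f (fun x => forall q : 'I_d * 'I_d * {set 'I_d},
    q.1.1 != q.1.2 -> q.1.1 \notin q.2 -> q.1.2 \notin q.2 ->
    cond_density f [set q.1.1; q.1.2]%SET q.2 x =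
      cc q.1.1 q.1.2 q.2 (coords q.2 x) (cond_cdf f q.1.1 q.2 x)
        (cond_cdf f q.1.2 q.2 x) *
      (cond_density f [set q.1.1]%SET q.2 x *
       cond_density f [set q.1.2]%SET q.2 x)).
  apply: ae_support_forall => -[[a b] S] /=.
  have [ab|] := boolP (a != b); last by move=> _; apply: aeW.
  have [aS|] := boolP (a \notin S); last by move=> _; apply: aeW.
  have [bS|] := boolP (b \notin S); last by move=> _; apply: aeW.
  have [_ _] := cc_copula a b S ab aS bS.
  by rewrite /ae_support; apply: filterS => t tE ft _ _ _; exact: tE.
rewrite /ae_support in pos cop ccop *.
apply: filterS3 pos cop ccop => t pos cop ccop ft.
move: (tnth t) {pos cop ccop} (pos ft) (cop ft) (ccop ft) => x f_gt0 cE ccE.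
pose w (D : {set 'I_d}) := c D (coords D (cdfs X x)).
pose h a b (S : {set 'I_d}) :=
  cc a b S (coords S x) (cond_cdf f a S x) (cond_cdf f b S x).
have w0 : forall D, w D != 0 by exact: copula_neq0 f_gt0 cE.
have w1 : forall v, w [set v]%SET = 1 by exact: copula_singleton f_gt0 cE.
have hE (a b : 'I_d) (S : {set 'I_d}) : a != b -> a \notin S -> b \notin S ->
    h a b S =
      w ([set a; b] :|: S)%SET * w S / (w (a |: S)%SET * w (b |: S)%SET).
  move=> ab aS bS; apply: (cond_copula_ratio f_gt0 cE ab aS bS).
  exact: (ccE (a, b, S)).
rewrite /cherry_wine_copula_density -TkJ -(T'E k) ?leqnn ?andbT; last exact: ltnW.
transitivity (junction_weight w (T' k)); first by [].
rewrite -(vine_product vT' w0 w1 hE) ?k_ge2 //.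
rewrite T'E ?(ltnW k_ge2) //; congr (_ * _).
by apply: eq_big_nat => i /andP[i2 ik]; rewrite T'E // (ltnW i2) ltnW.
Qed.
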